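(* Let $\Omega=\{1,\dots,d\}^{\mathbb N}$ with the shift $\sigma$, let $A:\Omega\to\mathbb R$ be Lipschitz continuous, let $h$ be the Peierls barrier of $A$ and $\mathcal A$ the Aubry set of $A$. Let $x,y,z\in\mathcal A$. If $h(x,y)+h(y,x)=0$ and $h(y,z)+h(z,y)=0$, then $h(x,z)+h(z,x)=0$.
   Context: $\Omega$ carries the metric $d(x,y)=2^{-\min\{n:\ x_n\ne y_n\}}$ and $\sigma(x_0x_1x_2\ldots)=x_1x_2\ldots$. $m(A)=\max\int A\,d\nu$ over $\sigma$-invariant Borel probability measures $\nu$. $S_n(f)=f+f\circ\sigma+\dots+f\circ\sigma^{n-1}$. The Peierls barrier is $$h(x,y)=\lim_{\epsilon\to0}\ \limsup_{n\to\infty}\ \sup\{S_n(A-m(A))(z):\ z\in\Omega,\ \sigma^n(z)=y,\ d(x,z)<\epsilon\}\in[-\infty,+\infty).$$ The Mañé potential is $S_A(x,y)=\lim_{\epsilon\to0}\sup\{S_n(A-m(A))(z):\ n\ge1,\ \sigma^n(z)=y,\ d(z,x)<\epsilon\}$, and the Aubry set is $\mathcal A=\{x\in\Omega:\ S_A(x,x)=0\}$. *)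

(* Defs.v *)
From HB Require Import structures.
From mathcomp Require Import all_boot all_order all_algebra.
From mathcomp Require Import all_classical all_reals all_analysis.

Set Implicit Arguments.
Unset Strict Implicit.
Unset Printing Implicit Defensive.

Import Order.TTheory GRing.Theory Num.Theory.
Import numFieldNormedType.Exports.

Local Open Scope classical_set_scope.
Local Open Scope ring_scope.

(* One-sided sequences over an alphabet of d.+1 >= 1 symbols.  The parameter R
   only says in which real numbers the metric takes its values. *)
Definition Omega (R : realType) (d : nat) : Type := nat -> 'I_d.+1.

HB.instance Definition _ (R : realType) (d : nat) := gen_eqMixin (Omega R d).
HB.instance Definition _ (R : realType) (d : nat) :=
  gen_choiceMixin (Omega R d).
HB.instance Definition _ (R : realType) (d : nat) :=
  isPointed.Build (Omega R d) (fun=> ord0).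

Section Metric.
Variables (R : realType) (d : nat).
Implicit Types x y z : Omega R d.

Definition Omega_dist x y : R :=
  if pselect (exists n, x n != y n) is left xDy then (2 ^+ ex_minn xDy)^-1
  else 0.

Lemma Omega_distxx x : Omega_dist x x = 0.
Proof.
have xEx : ~ exists n, x n != x n by move=> [n /eqP].
by rewrite /Omega_dist; case: pselect.
Qed.

Lemma Omega_dist_eq0 x y : Omega_dist x y = 0 -> x = y.
Proof.
rewrite /Omega_dist; case: pselect => [xDy /eqP|xEy _].
  by rewrite invr_eq0 expf_eq0 pnatr_eq0 andbF.
apply/funext => n; apply/eqP/negPn/negP => xDy.
by apply: xEy; exists n.
Qed.

Lemma Omega_dist_sym x y : Omega_dist x y = Omega_dist y x.
Proof.
rewrite /Omega_dist; case: pselect => xDy; case: pselect => yDx //.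
- case: ex_minnP => m xDm mP; case: ex_minnP => n yDn nP.
  have -> // : m = n.
  by apply/eqP; rewrite eqn_leq mP 1?eq_sym//= nP 1?eq_sym.
- by case: yDx; case: xDy => n; rewrite eq_sym; exists n.
- by case: xDy; case: yDx => n; rewrite eq_sym; exists n.
Qed.

Lemma Omega_dist_ge0 x y : 0 <= Omega_dist x y.
Proof.
by rewrite /Omega_dist; case: pselect => // ?; rewrite invr_ge0 exprn_ge0.
Qed.

Lemma Omega_dist_ge x y n : x n != y n -> (2 ^+ n)^-1 <= Omega_dist x y.
Proof.
move=> xnDyn; rewrite /Omega_dist.
case: pselect => [xDy|[]]; last by exists n.
case: ex_minnP => m _ /(_ _ xnDyn) mn.
by rewrite lef_pV2 ?posrE ?exprn_gt0// ler_weXn2l// ler1n.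
Qed.

Lemma Omega_dist_triangle y x z :
  Omega_dist x z <= Omega_dist x y + Omega_dist y z.
Proof.
rewrite {1}/Omega_dist; case: pselect => [xDz|_]; last first.
  by rewrite addr_ge0// Omega_dist_ge0.
case: ex_minnP => m xDm _.
have [xym|/Omega_dist_ge dxy] := eqVneq (x m) (y m); last first.
  by rewrite (le_trans dxy)// lerDl Omega_dist_ge0.
have /Omega_dist_ge dyz : y m != z m by rewrite -xym.
by rewrite (le_trans dyz)// lerDr Omega_dist_ge0.
Qed.

End Metric.

HB.instance Definition _ (R : realType) (d : nat) :=
  isMetric.Build R (Omega R d) (@Omega_distxx R d) (@Omega_dist_eq0 R d)
    (@Omega_dist_sym R d) (@Omega_dist_triangle R d).

Section Definitions.
Variables (R : realType) (d : nat).
Local Notation Omega := (Omega R d).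
Implicit Types (x y z : Omega) (A : Omega -> R).

Definition Omega_shift x : Omega := fun n => x n.+1.

Definition lipschitz_continuous A :=
  exists L : R, forall x y, `|A x - A y| <= L * mdist x y.

Definition borel_Omega := g_sigma_algebraType (@open Omega).

Definition shift_invariant (nu : probability borel_Omega R) :=
  forall B : set borel_Omega, measurable B -> nu (Omega_shift @^-1` B) = nu B.

(* For continuous A, by weak-* compactness of the set of invariant measures, this
   supremum is attained, so that it is the maximum. *)
Definition max_integral A : R :=
  sup [set \int[nu]_x A x | nu in shift_invariant].

Definition birkhoff_sum (f : Omega -> R) (n : nat) z : R :=
  \sum_(0 <= i < n) f (iter i Omega_shift z).

Definition normalized A : Omega -> R := fun z => A z - max_integral A.

Definition peierls_barrier A x y : \bar R :=
  lim ((limn_esup (fun n => ereal_sup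
    [set (birkhoff_sum (normalized A) n z)%:E | z in
      [set z | iter n Omega_shift z = y /\ mdist x z < eps]]))
    @[eps --> 0^'+]).

Definition mane_potential A x y : \bar R :=
  lim ((ereal_sup
    [set (birkhoff_sum (normalized A) nz.1 nz.2)%:E | nz in
      [set nz : nat * Omega | [/\ (1 <= nz.1)%N, iter nz.1 Omega_shift nz.2 = y
                                & mdist nz.2 x < eps]]])
    @[eps --> 0^'+]).

Definition aubry_set A : set Omega := [set x | mane_potential A x x = 0%E].

End Definitions.

(* Main.v *)
(** The barrier [h] is superadditive, [h x y + h y z <= h x z]: an orbit segment
    from near [x] to [y] is spliced with one from near [y] to [z], and the first
    segment moves by distances that halve at each step back in time, so that the
    Birkhoff sum of a Lipschitz function changes by at most [L * eps].  Hence
    [0 = h x y + h y z + h z y + h y x <= h x z + h z x <= h x x], and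
    [h x x <= S_A(x,x) = 0] on the Aubry set. *)
Require Import Defs.
From mathcomp Require Import all_boot all_order all_algebra.
From mathcomp Require Import all_classical all_reals all_analysis.
From mathcomp Require Import lra.

Set Implicit Arguments.
Unset Strict Implicit.
Unset Printing Implicit Defensive.

Import Order.TTheory GRing.Theory Num.Theory.

Local Open Scope classical_set_scope.
Local Open Scope ring_scope.

Lemma lee_addl_lt (R : realType) (a b c : \bar R) :
    (forall p : R, (p%:E < a)%E -> (p%:E + b <= c)%E) -> (a + b <= c)%E.
Proof.
move: a b => [r| |] [s| |] H; rewrite ?addNye ?addeNy ?leNye//.
- apply/lee_subgt0Pr => e e0; rewrite -!EFinD addrAC EFinD; apply: H.
  by rewrite lte_fin; lra.
- by apply: (H (r - 1)); rewrite lte_fin; lra.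
- rewrite leye_eq; apply/eqP/eqyP => t _.
  by rewrite -[t](subrK s) EFinD; apply: H; exact: ltry.
- by apply: (H 0); exact: ltry.
Qed.

Lemma lee_add_lt (R : realType) (a b c : \bar R) :
    (forall p q : R, (p%:E < a -> q%:E < b -> p%:E + q%:E <= c)%E) ->
  (a + b <= c)%E.
Proof.
move=> H; apply: lee_addl_lt => p pa; rewrite addeC.
by apply: lee_addl_lt => q qb; rewrite addeC; exact: H.
Qed.

Section Splicing.
Variables (R : realType) (d : nat).
Local Notation Omega := (Omega R d).
Local Notation shift := (@Omega_shift R d).
Implicit Types (u v w x y : Omega) (f A : Omega -> R).

Lemma mdist_shift x y : x 0%N = y 0%N ->
  mdist x y = mdist (shift x) (shift y) / 2.
Proof.
move=> xy0; rewrite /mdist/= /Omega_dist.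
case: pselect => xDy; case: pselect => sxDsy; last by rewrite mul0r.
- case: ex_minnP => -[|m]; first by rewrite xy0 eqxx.
  move=> xDm mP; case: ex_minnP => n yDn nP.
  have -> : m = n by apply/eqP; rewrite eqn_leq nP// -ltnS mP.
  by rewrite exprS invfM mulrC.
- by exfalso; case: xDy => -[|n] xDyn; [rewrite xy0 eqxx in xDyn|apply: sxDsy; exists n].
- by case: sxDsy => n xDyn; case: xDy; exists n.+1.
Qed.

Lemma birkhoff_sumD f m n w :
  birkhoff_sum f (m + n) w = birkhoff_sum f m w + birkhoff_sum f n (iter m shift w).
Proof.
rewrite /birkhoff_sum (big_cat_nat (n := m)) ?leq_addr//=; congr (_ + _).
rewrite -{1}[m]add0n (addnC m) big_addn addnK.
by apply: eq_bigr => i _; rewrite iterD.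
Qed.

(* Carrying [L * mdist v w] on the left makes the induction close: prepending a
   symbol halves the distance, which pays for the new term of the sum. *)
Lemma splice f L n w u :
    (forall x y, `|f x - f y| <= L * mdist x y) ->
  exists v, [/\ iter n shift v = u, mdist v w <= mdist u (iter n shift w) &
    `|birkhoff_sum f n v - birkhoff_sum f n w| + L * mdist v w
      <= L * mdist u (iter n shift w)].
Proof.
move=> fL; elim: n w => [|n IH] w.
  by exists u; split=> //; rewrite /birkhoff_sum !big_geq// subrr normr0 add0r.
have [v' [v'u v'w v's]] := IH (shift w).
pose v : Omega := fun i => if i is j.+1 then v' j else w 0%N.
have svE : shift v = v' by [].
have vw : mdist v w = mdist v' (shift w) / 2 by rewrite mdist_shift.
exists v; rewrite !iterSr svE; split=> //.
  by have := mdist_ge0 v' (shift w); lra.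
rewrite -[n.+1]add1n !birkhoff_sumD /= svE /birkhoff_sum !big_nat1/=.
rewrite -!/(birkhoff_sum _ _ _).
have := fL v w.
set a := f v - f w; set b := birkhoff_sum f n v' - birkhoff_sum f n (shift w).
have -> : f v + birkhoff_sum f n v' - (f w + birkhoff_sum f n (shift w)) = a + b.
  by rewrite /a /b; lra.
by have := ler_normD a b; move: v's; rewrite -/b vw; lra.
Qed.

End Splicing.

Section Barrier.
Variables (R : realType) (d : nat).
Local Notation Omega := (Omega R d).
Local Notation shift := (@Omega_shift R d).
Implicit Types (u v w x y z : Omega) (A : Omega -> R).

Lemma lim_at0_inf (F : R -> \bar R) :
    {in `]0, +oo[ &, {homo F : a b / a <= b >-> (a <= b)%E}} ->
  lim (F eps @[eps --> 0^'+]) = ereal_inf (F @` `]0, +oo[).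
Proof.
by move=> ndF; apply: cvg_lim => //; exact: nondecreasing_at_right_cvge.
Qed.

Let orbits x y n eps := [set w | iter n shift w = y /\ mdist x w < eps].

Let barrier_at A x y eps : \bar R := limn_esup (fun n => ereal_sup
  [set (birkhoff_sum (normalized A) n w)%:E | w in orbits x y n eps]).

Let peierls_barrierE A x y :
  peierls_barrier A x y = ereal_inf (barrier_at A x y @` `]0, +oo[).
Proof.
apply: lim_at0_inf => a b _ _ ab; apply: le_ereal_inf_tmp => _ [V Voo <-].
apply: ge_ereal_inf; exists (ereal_sup [set ereal_sup
    [set (birkhoff_sum (normalized A) n w)%:E | w in orbits x y n a] | n in V]).
  by exists V.
apply: ge_ereal_sup => _ [n Vn <-]; apply: le_trans; last first.
  by apply: ereal_sup_ubound; exists n.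
by apply: ereal_sup_le => _ [w [wy xw] <-]; exists w => //; split=> //; exact: lt_le_trans ab.
Qed.

Lemma lt_peierls_barrier A x y (p eps : R) N :
    0 < eps -> (p%:E < peierls_barrier A x y)%E ->
  exists n w, [/\ (N <= n)%N, iter n shift w = y, mdist x w < eps &
    p < birkhoff_sum (normalized A) n w].
Proof.
move=> e0; rewrite peierls_barrierE => ph.
have {}ph : (p%:E < barrier_at A x y eps)%E.
  apply: lt_le_trans ph _; apply: ereal_inf_lbound.
  by exists eps; rewrite //= in_itv/= e0.
have : (p%:E < ereal_sup [set ereal_sup
    [set (birkhoff_sum (normalized A) n w)%:E | w in orbits x y n eps]
    | n in [set n | (N <= n)%N]])%E.
  apply: lt_le_trans ph _; apply: ereal_inf_lbound.
  by exists [set n | (N <= n)%N] => //; exists N.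
move=> /ereal_sup_gt[_ [n /= Nn <-]] /ereal_sup_gt[_ [w [wy xw] <-]].
by rewrite lte_fin => pw; exists n, w.
Qed.

Lemma le_peierls_barrier A x y (p : R) :
    (forall N eps, 0 < eps -> exists n w, [/\ (N <= n)%N, iter n shift w = y,
      mdist x w < eps & p - eps <= birkhoff_sum (normalized A) n w]) ->
  (p%:E <= peierls_barrier A x y)%E.
Proof.
move=> H; rewrite peierls_barrierE; apply: le_ereal_inf_tmp => _ [eps + <-].
rewrite /= in_itv/= andbT => eps0.
apply: le_ereal_inf_tmp => _ [V [N _ NV] <-].
apply/lee_addgt0Pr => e e0.
have /(H N)[n [w [Nn wy]]] : 0 < Num.min eps e by rewrite lt_min eps0.
rewrite lt_min => /andP[xw _] pw; rewrite -leeBlDr//.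
apply: (@le_trans _ _ (birkhoff_sum (normalized A) n w)%:E).
  rewrite -EFinB lee_fin; apply: le_trans pw.
  by rewrite lerB// ge_min lexx orbT.
apply: le_trans; last by apply: ereal_sup_ubound; exists n => //; exact: NV.
by apply: ereal_sup_ubound; exists w.
Qed.

Lemma peierls_barrier_superadditive A x y z : lipschitz_continuous A ->
  (peierls_barrier A x y + peierls_barrier A y z <= peierls_barrier A x z)%E.
Proof.
move=> [L AL]; apply: lee_add_lt => p q ph qh; rewrite -EFinD.
apply: le_peierls_barrier => N eps eps0.
have L0 : 0 < `|L| + 1 by have := normr_ge0 L; lra.
have fL u v : `|normalized A u - normalized A v| <= (`|L| + 1) * mdist u v.
  rewrite /normalized opprB addrA subrK (le_trans (AL u v))//.
  by rewrite ler_wpM2r ?mdist_ge0//; have := ler_norm L; lra.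
pose del := Num.min (eps / 2) (eps / (`|L| + 1)).
have del0 : 0 < del by rewrite lt_min !divr_gt0.
have [n [w1 [Nn w1y xw1 pw1]]] := lt_peierls_barrier N del0 ph.
have [m [w2 [_ w2z yw2 qw2]]] := lt_peierls_barrier 0 del0 qh.
have [v [vw2 vw1 vs]] := splice n w1 w2 fL.
exists (n + m)%N, v; split.
- exact: leq_trans Nn (leq_addr _ _).
- by rewrite addnC iterD vw2.
- move: vw1; rewrite w1y (metric_sym w2) => vw1.
  have := metric_triangle x w1 v; rewrite (metric_sym w1).
  by move: xw1 yw2; rewrite !lt_min => /andP[? _] /andP[? _]; lra.
- move: yw2 vs; rewrite lt_min w1y (metric_sym w2) => /andP[_].
  rewrite ltr_pdivlMr// mulrC birkhoff_sumD vw2.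
  have := mulr_ge0 (ltW L0) (mdist_ge0 v w1).
  have := ler_norm (birkhoff_sum (normalized A) n w1 - birkhoff_sum (normalized A) n v).
  by rewrite distrC; lra.
Qed.

Lemma peierls_barrier_le_mane A x y :
  (peierls_barrier A x y <= mane_potential A x y)%E.
Proof.
rewrite /mane_potential lim_at0_inf; last first.
  move=> a b _ _ ab; apply: ereal_sup_le => _ [nw [n0 wy wx] <-].
  by exists nw => //; split=> //; exact: lt_le_trans ab.
rewrite peierls_barrierE; apply: le_ereal_inf_tmp => _ [eps eps0 <-].
apply: ge_ereal_inf; exists (barrier_at A x y eps); first by exists eps.
apply: ge_ereal_inf; eexists; first by exists [set n | (1 <= n)%N] => //; exists 1%N.
apply: ge_ereal_sup => _ [n n1 <-]; apply: ge_ereal_sup => _ [w [wy xw] <-].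
by apply: ereal_sup_ubound; exists (n, w) => //; split; rewrite //= metric_sym.
Qed.

End Barrier.

Theorem lemma4p4 (R : realType) (d : nat) (A : Omega R d -> R)
    (hA : lipschitz_continuous A) (x y z : Omega R d)
    (hx : aubry_set A x) (hy : aubry_set A y) (hz : aubry_set A z)
    (hxy : (peierls_barrier A x y + peierls_barrier A y x = 0)%E)
    (hyz : (peierls_barrier A y z + peierls_barrier A z y = 0)%E) :
  (peierls_barrier A x z + peierls_barrier A z x = 0)%E.
Proof.
apply/eqP; rewrite eq_le; apply/andP; split.
  apply: le_trans (peierls_barrier_superadditive x z x hA) _.
  by rewrite -hx; exact: peierls_barrier_le_mane.
apply: le_trans (leeD (peierls_barrier_superadditive x y z hA)
                      (peierls_barrier_superadditive z y x hA)).
move: hxy hyz.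
case: (peierls_barrier A x y) => [a| |]; case: (peierls_barrier A y x) => [b| |] //.
case: (peierls_barrier A y z) => [c| |]; case: (peierls_barrier A z y) => [e| |] //.
by move=> [ab] [ce]; rewrite -!EFinD lee_fin; lra.
Qed.
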